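(* Let $k$ be a perfect field of prime characteristic $p$. Let $g\in k[[t]]$ be any power series such that $g(0)=0$ and $\frac{dg}{dt}\notin k(t,g)$, and let $V$ be the discrete valuation ring $k(t,g)\cap k[[t]]$. Then for each $n\in\mathbb N$, the inclusion $V\hookrightarrow \mathrm{End}_V(F^n_*V)$ (sending $v$ to multiplication by $v$ on the ring $V$, the underlying group of $F^n_*V$) is an isomorphism.
   Context: $k(t,g)$ denotes the subfield of $k((t))=k[[t]][\frac1t]$ generated over $k$ by $t$ and $g$; the intersection is taken in $k((t))$, and $\frac{d}{dt}$ is the formal derivative. For a commutative ring $V$ of characteristic $p$, $F^n_*V$ denotes $V$ viewed as a $V$-module by restriction of scalars along the Frobenius map $v\mapsto v^{p^n}$, so that $\mathrm{End}_V(F^n_*V)$ is the ring of additive maps $\phi:V\to V$ with $\phi(v^{p^n}x)=v^{p^n}\phi(x)$ for all $v,x\in V$. *)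

(* Defs.v *)
From HB Require Import structures.
From mathcomp Require Import all_boot all_order all_algebra.
From mathcomp Require Import generic_quotient fraction.
From mathcomp Require Import boolp classical_sets.

Set Implicit Arguments.
Unset Strict Implicit.
Unset Printing Implicit Defensive.

Import GRing.Theory.
Local Open Scope quotient_scope.
Local Open Scope ring_scope.

Record fps (R : Type) := FPS { fps_coef :> nat -> R }.

HB.instance Definition _ (R : Type) := gen_eqMixin (fps R).
HB.instance Definition _ (R : Type) := gen_choiceMixin (fps R).

Lemma fpsP (R : Type) (f g : fps R) : f =1 g -> f = g.
Proof. by case: f g => [f] [g] /= /funext ->. Qed.

Section FpsRing.
Variable R : comNzRingType.
Implicit Types f g h : fps R.

Definition fps_zero := FPS (fun _ => 0 : R).
Definition fps_opp f := FPS (fun i => - f i).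
Definition fps_add f g := FPS (fun i => f i + g i).
Definition fpsC (c : R) := FPS (fun i => if i == 0%N then c else 0).
Definition fpsX := FPS (fun i => (i == 1%N)%:R : R).
Definition fps_mul f g := FPS (fun n => \sum_(i < n.+1) f i * g (n - i)%N).

Fact fps_addA : associative fps_add.
Proof. by move=> f g h; apply: fpsP => i /=; rewrite addrA. Qed.
Fact fps_addC : commutative fps_add.
Proof. by move=> f g; apply: fpsP => i /=; rewrite addrC. Qed.
Fact fps_add0 : left_id fps_zero fps_add.
Proof. by move=> f; apply: fpsP => i /=; rewrite add0r. Qed.
Fact fps_addN : left_inverse fps_zero fps_opp fps_add.
Proof. by move=> f; apply: fpsP => i /=; rewrite addNr. Qed.

HB.instance Definition _ :=
  GRing.isZmodule.Build (fps R) fps_addA fps_addC fps_add0 fps_addN.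

Definition fps_trunc n f : {poly R} := \poly_(i < n) f i.

Lemma coef_fps_trunc n f i : (i < n)%N -> (fps_trunc n f)`_i = f i.
Proof. by move=> lt_in; rewrite coef_poly lt_in. Qed.

Lemma fps_mul_coefM f g (P Q : {poly R}) n :
    (forall i, (i <= n)%N -> P`_i = f i) ->
    (forall i, (i <= n)%N -> Q`_i = g i) ->
  forall i, (i <= n)%N -> (P * Q)`_i = fps_mul f g i.
Proof.
move=> fP gQ i le_in; rewrite coefM /=; apply: eq_bigr => j _.
rewrite fP ?gQ // (leq_trans _ le_in) ?leq_subr //.
by rewrite -ltnS ltn_ord.
Qed.

Fact fps_mulA : associative fps_mul.
Proof.
move=> f g h; apply: fpsP => n.
pose T u := fps_trunc n.+1 u.
have TE u i : (i <= n)%N -> (T u)`_i = u i by move=> ?; rewrite coef_fps_trunc.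
have TM u v := fps_mul_coefM (TE u) (TE v).
rewrite -(fps_mul_coefM (TE f) (TM g h) (leqnn n)).
by rewrite -(fps_mul_coefM (TM f g) (TE h) (leqnn n)) mulrA.
Qed.

Fact fps_mulC : commutative fps_mul.
Proof.
move=> f g; apply: fpsP => n.
have TE u i : (i <= n)%N -> (fps_trunc n.+1 u)`_i = u i
  by move=> ?; rewrite coef_fps_trunc.
rewrite -(fps_mul_coefM (TE f) (TE g) (leqnn n)).
by rewrite -(fps_mul_coefM (TE g) (TE f) (leqnn n)) mulrC.
Qed.

Fact fps_mul1 : left_id (fpsC 1) fps_mul.
Proof.
move=> f; apply: fpsP => n /=; rewrite big_ord_recl /= mul1r subn0.
by rewrite big1 ?addr0 // => i _; rewrite mul0r.
Qed.

Fact fps_mulDl : left_distributive fps_mul +%R.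
Proof.
move=> f g h; apply: fpsP => n /=; rewrite -big_split /=.
by apply: eq_bigr => i _; rewrite mulrDl.
Qed.

Fact fps_1neq0 : fpsC 1 != 0.
Proof. by apply/eqP => /(congr1 (fun f : fps R => f 0%N)) /eqP; rewrite oner_eq0. Qed.

HB.instance Definition _ := GRing.Zmodule_isComNzRing.Build (fps R)
  fps_mulA fps_mulC fps_mul1 fps_mulDl fps_1neq0.

Lemma fpsD f g i : (f + g) i = f i + g i. Proof. by []. Qed.
Lemma fpsN f i : (- f) i = - f i. Proof. by []. Qed.
Lemma fps0 i : (0 : fps R) i = 0. Proof. by []. Qed.
Lemma fps1 i : (1 : fps R) i = (i == 0%N)%:R. Proof. by case: i. Qed.
Lemma fpsM f g n : (f * g) n = \sum_(i < n.+1) f i * g (n - i)%N.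
Proof. by []. Qed.

Fact fpsC_zmod_morphism : zmod_morphism fpsC.
Proof. by move=> a b; apply: fpsP => -[|i] //=; rewrite subr0. Qed.

Fact fpsC_monoid_morphism : monoid_morphism fpsC.
Proof.
split=> // a b; apply: fpsP => n; rewrite fpsM big_ord_recl /= subn0.
rewrite big1 => [|i _]; last by rewrite mul0r.
by case: n => [|n] /=; rewrite ?mulr0 addr0.
Qed.

HB.instance Definition _ :=
  GRing.isZmodMorphism.Build R (fps R) fpsC fpsC_zmod_morphism.
HB.instance Definition _ :=
  GRing.isMonoidMorphism.Build R (fps R) fpsC fpsC_monoid_morphism.

Definition fps_deriv f : fps R := FPS (fun i => f i.+1 *+ i.+1).

Lemma fpsMX f n : (f * fpsX) n = if n is m.+1 then f m else 0.
Proof.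
rewrite mulrC fpsM; case: n => [|n]; first by rewrite big_ord1 mul0r.
rewrite big_ord_recl mul0r add0r big_ord_recl /= mul1r subSS subn0.
by rewrite big1 ?addr0 // => i _; rewrite mul0r.
Qed.

Lemma fpsMXn f m n : (f * fpsX ^+ m) n = if (n < m)%N then 0 else f (n - m)%N.
Proof.
elim: m n => [|m IHm] n; first by rewrite mulr1 subn0.
by rewrite exprSr mulrA fpsMX; case: n => // n; rewrite IHm ltnS subSS.
Qed.

End FpsRing.

Section FpsField.
Variable k : fieldType.
Implicit Types f g : fps k.

Fixpoint fps_inv_seq f n : seq k :=
  if n is m.+1 then
    let s := fps_inv_seq f m in
    rcons s (- (f 0%N)^-1 * \sum_(i < m.+1) s`_i * f (m.+1 - i)%N)
  else [:: (f 0%N)^-1].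

Lemma size_fps_inv_seq f n : size (fps_inv_seq f n) = n.+1.
Proof. by elim: n => //= n IHn; rewrite size_rcons IHn. Qed.

Lemma nth_fps_inv_seq f n i : (i <= n)%N ->
  (fps_inv_seq f n)`_i = (fps_inv_seq f i)`_i.
Proof.
elim: n => [|n IHn]; first by case: i.
rewrite leq_eqVlt => /predU1P[-> //|lt_in].
by rewrite /= nth_rcons size_fps_inv_seq lt_in IHn.
Qed.

Definition fps_unit : pred (fps k) := fun f => f 0%N != 0.
Definition fps_inv f : fps k :=
  if fps_unit f then FPS (fun n => (fps_inv_seq f n)`_n) else f.

Fact fps_mulVr : {in fps_unit, left_inverse 1 fps_inv *%R}.
Proof.
move=> f Uf; have fn0 : f 0%N != 0 by [].
rewrite /fps_inv (_ : fps_unit f = true) //; apply: fpsP => n.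
rewrite fpsM fps1 /=; case: n => [|n]; first by rewrite big_ord1 /= mulVf.
rewrite big_ord_recr /= nth_rcons size_fps_inv_seq ltnn eqxx subnn.
rewrite mulrAC mulNr mulVf // mulN1r; apply/eqP; rewrite subr_eq0; apply/eqP.
by apply: eq_bigr => i _; rewrite (nth_fps_inv_seq f (n := n)) // -ltnS.
Qed.

Fact fps_unitPl f g : g * f = 1 -> fps_unit f.
Proof.
move=> /(congr1 (fun h : fps k => h 0%N)).
rewrite fpsM big_ord1 fps1 /fps_unit => gf1; apply: contra_eq_neq gf1 => ->.
by rewrite mulr0 eq_sym oner_neq0.
Qed.

Fact fps_invr_out : {in [predC fps_unit], fps_inv =1 id}.
Proof. by move=> f /negbTE; rewrite /fps_inv /in_mem /= => ->. Qed.

HB.instance Definition _ := GRing.ComNzRing_hasMulInverse.Build (fps k)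
  fps_mulVr fps_unitPl fps_invr_out.

Lemma fps_decomp f : f != 0 ->
  exists m (u : fps k), u \is a GRing.unit /\ f = u * fpsX k ^+ m.
Proof.
move=> fn0; have ex_n : exists n, f n != 0.
  apply: contrapT => all0; case/eqP: fn0; apply: fpsP => i.
  by apply/eqP; apply: contrapT => /negP fi; apply: all0; exists i.
case: (ex_minnP ex_n) => m fm minm.
exists m, (FPS (fun i => f (i + m)%N)); split; first exact: fm.
apply: fpsP => n; rewrite fpsMXn /=; case: ltnP => [lt_nm|/subnK-> //].
by apply/eqP; apply: contraTT lt_nm => /minm; rewrite -leqNgt.
Qed.

Fact fps_mulf_eq0 f g : f * g = 0 -> (f == 0) || (g == 0).
Proof.
move=> fg0; have [//|/fps_decomp[m [u [Uu fE]]] /=] := eqVneq f 0.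
have ug0 : u * g * fpsX k ^+ m = 0 by rewrite mulrAC -fE.
have {}ug0 : u * g = 0.
  apply: fpsP => i; have := fpsMXn (u * g) m (i + m).
  by rewrite ug0 ltnNge leq_addl addnK.
by rewrite -(mulKr Uu g) ug0 mulr0.
Qed.

HB.instance Definition _ :=
  GRing.ComUnitRing_isIntegral.Build (fps k) fps_mulf_eq0.

End FpsField.

(* k((t)) is taken to be the fraction field of k[[t]]; laurentE checks that it
   is k[[t]][1/t] *)
Notation laurent k := {fraction (fps k)}.
Notation "f %:F" := (@FracField.tofrac _ f) : ring_scope.

Lemma frac_numden (R : idomainType) (x : {fraction R}) :
  exists a b : R, b != 0 /\ x = a%:F / b%:F.
Proof.
rewrite -[x]reprK; set r := repr x; exists \n_r, \d_r.
split; first exact: denom_ratioP.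
have d0 : (\d_r)%:F != 0 by rewrite tofrac_eq0 denom_ratioP.
apply: (canRL (mulfK d0)); unlock FracField.tofrac.
rewrite -[LHS]FracField.pi_mul; apply/eqmodP; rewrite /= FracField.equivfE.
have d1 := denom_ratioP r.
rewrite /FracField.mulf !numden_Ratio ?oner_neq0 ?mulr1 //; exact/eqP/mulrC.
Qed.

Lemma laurentE (k : fieldType) (x : laurent k) :
  exists (f : fps k) (m : nat), x = f%:F / (fpsX k)%:F ^+ m.
Proof.
have [a [b [/fps_decomp[m [u [Uu ->]]] ->]]] := frac_numden x.
exists (a / u), m; rewrite tofracM tofracXn rmorphM invfM mulrA; congr (_ / _).
by rewrite rmorphV.
Qed.

(* the convention 0^-1 = 0 makes divring_closed subsets exactly the subfields *)
Definition is_subfield (K : fieldType) (S : set K) : Prop :=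
  GRing.divring_closed (mem S).

Definition generated_subfield (K : fieldType) (G : set K) : set K :=
  smallest (@is_subfield K) G.

Section RingV.
Variables (k : fieldType) (g : fps k).
Local Open Scope classical_set_scope.

Definition kt_field : set (laurent k) :=
  generated_subfield
    (range (fun c : k => (fpsC c)%:F) `|` [set (fpsX k)%:F; g%:F]).

Definition ringV_set : set (laurent k) :=
  kt_field `&` range (fun f : fps k => f%:F).

Lemma kt_field_subfield : is_subfield kt_field.
Proof.
split=> [|x y|x y]; rewrite !inE.
- by move=> S [[S1 _ _] _]; rewrite inE in S1.
- move=> xS yS S SP; have [_ SB _] := SP.1; have := SB x y; rewrite !inE.
  by apply; [apply: xS | apply: yS].
- move=> xS yS S SP; have [_ _ SV] := SP.1; have := SV x y; rewrite !inE.
  by apply; [apply: xS | apply: yS].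
Qed.

Definition ringV_pred : {pred laurent k} := fun x => x \in ringV_set.

Fact ringV_subring_closed : subring_closed ringV_pred.
Proof.
have [K1 KB KV] := kt_field_subfield.
have KM : {in kt_field &, forall x y, x * y \in kt_field}.
  move=> x y xK yK; rewrite -[y]invrK KV //.
  by rewrite -[_^-1]mul1r KV.
have VP x : reflect (exists2 a : fps k, x \in kt_field & a%:F = x)
    (x \in ringV_pred).
  apply: (iffP (asboolP _)) => [[xK [a _ ax]]|[a xK ax]].
    by exists a; first exact/mem_set.
  by split; [apply: set_mem | exists a].
split=> [|x y /VP[a xK ax] /VP[b yK bx]|x y /VP[a xK ax] /VP[b yK bx]].
- by apply/VP; exists 1; rewrite ?rmorph1.
- by apply/VP; exists (a - b); [apply: KB | rewrite tofracB ax bx].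
- by apply/VP; exists (a * b); [apply: KM | rewrite tofracM ax bx].
Qed.

HB.instance Definition _ :=
  GRing.isSubringClosed.Build (laurent k) ringV_pred ringV_subring_closed.

Record ringV := RingV { ringV_val :> laurent k; _ : ringV_val \in ringV_pred }.

HB.instance Definition _ := [isSub for ringV_val].
HB.instance Definition _ := [Choice of ringV by <:].
HB.instance Definition _ := [SubChoice_isSubComNzRing of ringV by <:].

Lemma pchar_ringV p : p \in [pchar k] -> p \in [pchar ringV].
Proof.
move=> pk; have pL : p \in [pchar laurent k].
  exact: (rmorph_pchar (@FracField.tofrac (fps k)) (rmorph_pchar (@fpsC k) pk)).
rewrite inE (pcharf_prime pL) /=; apply/eqP/val_inj.
by rewrite rmorph_nat (pcharf0 pL) rmorph0.
Qed.

End RingV.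

(* F^n_* R : the group R, on which v : R acts as multiplication by v ^+ (p ^ n).
   The proof pR is a parameter because additivity of the action needs it. *)
Definition frobenius_push (R : comNzRingType) (p : nat) (pR : p \in [pchar R])
  (n : nat) : Type := R.

Section FrobeniusPush.
Variables (R : comNzRingType) (p : nat) (pR : p \in [pchar R]) (n : nat).

HB.instance Definition _ := GRing.Zmodule.on (frobenius_push pR n).

Definition frobenius_scale (v : R) (x : frobenius_push pR n) :
  frobenius_push pR n := v ^+ (p ^ n) * (x : R).

Fact frobenius_scaleA a b x :
  frobenius_scale a (frobenius_scale b x) = frobenius_scale (a * b) x.
Proof. by rewrite /frobenius_scale mulrA exprMn. Qed.
Fact frobenius_scale1 : left_id 1 frobenius_scale.
Proof. by move=> x; rewrite /frobenius_scale expr1n mul1r. Qed.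
Fact frobenius_scaleDr : right_distributive frobenius_scale +%R.
Proof. by move=> a x y; rewrite /frobenius_scale mulrDr. Qed.
Fact frobenius_scaleDl x : {morph frobenius_scale^~ x : a b / a + b}.
Proof.
move=> a b; rewrite /frobenius_scale exprDn_pchar ?mulrDl //.
by rewrite pnatX pnatE ?(pcharf_prime pR) // pR.
Qed.

HB.instance Definition _ := GRing.Zmodule_isLmodule.Build R
  (frobenius_push pR n) frobenius_scaleA frobenius_scale1 frobenius_scaleDr
  frobenius_scaleDl.

End FrobeniusPush.

Definition endo (R : pzRingType) (U : lmodType R) : Type := {linear U -> U}.

Section EndoRing.
Variables (R : comPzRingType) (U : lmodType R).

Definition endo_fun (f : endo U) : {linear U -> U} := f.
Coercion endo_fun : endo >-> GRing.Linear.type.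

HB.instance Definition _ := gen_eqMixin (endo U).
HB.instance Definition _ := gen_choiceMixin (endo U).

Implicit Types f h e : endo U.

Lemma endoP f h : f =1 h -> f = h.
Proof.
case: f h => [f [[f1] [f2]]] [h [[h1] [h2]]] /= /funext fh.
move: h1 h2; rewrite -{}fh => h1 h2.
by rewrite (Prop_irrelevance f1 h1) (Prop_irrelevance f2 h2).
Qed.

Definition endo0 : endo U := (\0 : {linear U -> U}).
Definition endo_opp f : endo U := (\- f : {linear U -> U}).
Definition endo_add f h : endo U := (f \+ h : {linear U -> U}).
Definition endo1 : endo U := (idfun : {linear U -> U}).
Definition endo_mul f h : endo U := (f \o h : {linear U -> U}).

Fact endo_addA : associative endo_add.
Proof. by move=> f h e; apply: endoP => x /=; rewrite addrA. Qed.
Fact endo_addC : commutative endo_add.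
Proof. by move=> f h; apply: endoP => x /=; rewrite addrC. Qed.
Fact endo_add0 : left_id endo0 endo_add.
Proof. by move=> f; apply: endoP => x /=; rewrite add0r. Qed.
Fact endo_addN : left_inverse endo0 endo_opp endo_add.
Proof. by move=> f; apply: endoP => x /=; rewrite addNr. Qed.

HB.instance Definition _ :=
  GRing.isZmodule.Build (endo U) endo_addA endo_addC endo_add0 endo_addN.

Fact endo_mulA : associative endo_mul.
Proof. by move=> f h e; apply: endoP. Qed.
Fact endo_mul1 : left_id endo1 endo_mul.
Proof. by move=> f; apply: endoP. Qed.
Fact endo_1mul : right_id endo1 endo_mul.
Proof. by move=> f; apply: endoP. Qed.
Fact endo_mulDl : left_distributive endo_mul +%R.
Proof. by move=> f h e; apply: endoP. Qed.
Fact endo_mulDr : right_distributive endo_mul +%R.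
Proof. by move=> f h e; apply: endoP => x; rewrite /= raddfD. Qed.

HB.instance Definition _ := GRing.Zmodule_isPzRing.Build (endo U)
  endo_mulA endo_mul1 endo_1mul endo_mulDl endo_mulDr.

End EndoRing.

Section MulEndo.
Variables (R : comNzRingType) (p : nat) (pR : p \in [pchar R]) (n : nat).
Local Notation FR := (frobenius_push pR n).

Definition mul_push (v : R) (x : FR) : FR := v * (x : R).

Fact mul_push_zmod_morphism v : zmod_morphism (mul_push v).
Proof. by move=> x y; rewrite /mul_push mulrBr. Qed.
Fact mul_push_scalable v : scalable (mul_push v).
Proof. by move=> a x; apply: mulrCA. Qed.

HB.instance Definition _ v :=
  GRing.isZmodMorphism.Build FR FR (mul_push v) (mul_push_zmod_morphism v).
HB.instance Definition _ v :=
  GRing.isScalable.Build R FR FR *:%R (mul_push v) (mul_push_scalable v).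

Definition mul_endo (v : R) : endo FR := (mul_push v : {linear FR -> FR}).

Fact mul_endo_zmod_morphism : zmod_morphism mul_endo.
Proof. by move=> a b; apply: endoP => x; apply: mulrBl. Qed.
Fact mul_endo_monoid_morphism : monoid_morphism mul_endo.
Proof.
by split=> [|a b]; apply: endoP => x; [apply: mul1r | apply/esym/mulrA].
Qed.

HB.instance Definition _ := GRing.isZmodMorphism.Build R (endo FR) mul_endo
  mul_endo_zmod_morphism.
HB.instance Definition _ := GRing.isMonoidMorphism.Build R (endo FR) mul_endo
  mul_endo_monoid_morphism.

End MulEndo.

(* Main.v *)
(** Let [q = p ^ n], let [phi : V -> V] be additive and [V^q]-linear, and put
    [ad phi x = phi (t x) - t (phi x)].  As [(X - t)^q = X^q - t^q] in
    characteristic [p], the [q]-th iterate of [ad] kills [phi], so by induction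
    we may assume that [ad phi] is multiplication by some [c] in [V].  Then
    [E v = phi v - phi 1 * v - c * v'], with values in [k[[t]]], vanishes on the
    constants, because [k] is perfect, and satisfies [E (t w) = t (E w)].  Every
    [v] in [V] is a constant plus [t w] with [w] in [V], so [E = 0].  Taking
    [v = g] shows that [c g'] lies in [V], hence [c = 0], as [g'] is not in
    [k(t, g)]; thus [phi] is multiplication by [phi 1]. *)
Require Import Defs.
From HB Require Import structures.
From mathcomp Require Import all_boot all_order all_algebra.
From mathcomp Require Import fraction.
From mathcomp Require Import boolp classical_sets ring.

Set Implicit Arguments.
Unset Strict Implicit.
Unset Printing Implicit Defensive.

Import GRing.Theory.
Local Open Scope ring_scope.

(** * Formal differentiation of power series *)

Lemma fps_derivMX (R : comNzRingType) (f : fps R) :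
  fps_deriv (fpsX R * f) = f + fpsX R * fps_deriv f.
Proof.
apply: fpsP => i; rewrite ![fpsX R * _]mulrC fpsD fpsMX.
rewrite -[fps_deriv _ i]/((f * fpsX R) i.+1 *+ i.+1) fpsMX.
by case: i => [|i]; rewrite ?addr0 // mulrS.
Qed.

Lemma fps_derivC (R : comNzRingType) (c : R) : fps_deriv (fpsC c) = 0.
Proof. by apply: fpsP => i; rewrite /= mul0rn. Qed.

Lemma tofrac_inj (R : idomainType) : injective (@FracField.tofrac R).
Proof. by move=> a b /eqP; rewrite tofrac_eq => /eqP. Qed.

(** * The ring [V] inside [k[[t]]] *)

Section RingVTheory.
Variables (k : fieldType) (g : fps k).
Local Notation V := (ringV g).
Implicit Types (v w : V) (f : fps k).

Lemma kt_fieldB x y :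
  kt_field g x -> kt_field g y -> kt_field g (x - y).
Proof.
by case: (kt_field_subfield g) => _ SB _ /mem_set ? /mem_set ?;
  exact/set_mem/SB.
Qed.

Lemma kt_fieldV x y :
  kt_field g x -> kt_field g y -> kt_field g (x / y).
Proof.
by case: (kt_field_subfield g) => _ _ SV /mem_set ? /mem_set ?;
  exact/set_mem/SV.
Qed.

Lemma kt_field_gen x :
  (range (fun c : k => (fpsC c)%:F) `|` [set (fpsX k)%:F; g%:F])%classic x ->
  kt_field g x.
Proof. by move=> Gx S [_]; apply. Qed.

Lemma ringV_of_subproof f : kt_field g f%:F -> f%:F \in ringV_pred g.
Proof. by move=> fK; apply/mem_set; split=> //; exists f. Qed.

Definition ringV_of f (fK : kt_field g f%:F) : V :=
  RingV (ringV_of_subproof fK).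

Lemma kt_field_ringV v : kt_field g (val v).
Proof. by have /set_mem[] := valP v. Qed.

Lemma ringV_fps_subproof v : exists f, f%:F = val v.
Proof. by have /set_mem[_ [f _ <-]] := valP v; exists f. Qed.

(** The choice made by [cid] is unique, as [tofrac] is injective. This is the inclusion of [V] into
    [k[[t]]], where differentiation makes sense. *)
Definition ringV_fps v : fps k := projT1 (cid (ringV_fps_subproof v)).

Lemma ringV_fpsK v : (ringV_fps v)%:F = val v.
Proof. by rewrite /ringV_fps; case: cid. Qed.

Lemma ringV_fps_of f (fK : kt_field g f%:F) : ringV_fps (ringV_of fK) = f.
Proof. by apply: tofrac_inj; rewrite ringV_fpsK. Qed.

Lemma ringV_fps_inj : injective ringV_fps.
Proof. by move=> v w vw; apply: val_inj; rewrite /= -!ringV_fpsK vw. Qed.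

Fact ringV_fps_is_zmod_morphism : zmod_morphism ringV_fps.
Proof.
by move=> v w; apply: tofrac_inj; rewrite tofracB !ringV_fpsK rmorphB.
Qed.

Fact ringV_fps_is_monoid_morphism : monoid_morphism ringV_fps.
Proof.
split=> [|v w]; apply: tofrac_inj; first by rewrite ringV_fpsK !rmorph1.
by rewrite tofracM !ringV_fpsK rmorphM.
Qed.

HB.instance Definition _ := GRing.isZmodMorphism.Build V (fps k) ringV_fps
  ringV_fps_is_zmod_morphism.
HB.instance Definition _ := GRing.isMonoidMorphism.Build V (fps k) ringV_fps
  ringV_fps_is_monoid_morphism.

Definition ringVX : V := ringV_of (kt_field_gen (or_intror (or_introl erefl))).
Definition ringVg : V := ringV_of (kt_field_gen (or_intror (or_intror erefl))).
Definition ringVC (c : k) : V :=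
  ringV_of (kt_field_gen (or_introl (imageT (fun c => (fpsC c)%:F) c))).

(** The quotient of [f - f(0)] by [t] is both a power series and an element of [k(t, g)]. *)
Lemma ringV_decomp v : exists c w, v = ringVC c + ringVX * w.
Proof.
pose f := ringV_fps v; pose h := FPS (fun i => f i.+1).
have fE : f = fpsC (f 0%N) + fpsX k * h.
  by apply: fpsP => -[|i]; rewrite fpsD mulrC fpsMX /= ?addr0 ?add0r.
have X0 : (fpsX k)%:F != 0.
  rewrite tofrac_eq0; apply/eqP => /(congr1 (fun f : fps k => f 1%N)) /eqP.
  by rewrite /= oner_eq0.
have hK : kt_field g h%:F.
  have -> : h%:F = (f%:F - (fpsC (f 0%N))%:F) / (fpsX k)%:F.
    by rewrite [in f%:F]fE tofracD tofracM addrAC subrr add0r mulrAC mulfV //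
      mul1r.
  apply: kt_fieldV; last exact: kt_field_gen (or_intror (or_introl erefl)).
  apply: kt_fieldB; first by rewrite ringV_fpsK; apply: kt_field_ringV.
  by apply: kt_field_gen; left; exists (f 0%N).
exists (f 0%N), (ringV_of hK); apply: ringV_fps_inj.
by rewrite rmorphD rmorphM /= !ringV_fps_of.
Qed.

(** * Iterated commutators with multiplication by [t] *)

Definition ad (phi : V -> V) x := phi (ringVX * x) - ringVX * phi x.

(* The powers of ['X] multiply the argument of [phi] by [t], so multiplying [P]
   by ['X - t] applies [ad], and the iterates of [ad] become powers in the
   commutative ring [{poly V}]. *)
Definition act (phi : V -> V) (P : {poly V}) (x : V) :=
  \sum_(i < size P) P`_i * phi (ringVX ^+ i * x).

(** Padding with zero coefficients lets polynomials of different sizes be compared over one range of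
    summation. *)
Lemma act_widen phi (P : {poly V}) m x : (size P <= m)%N ->
  act phi P x = \sum_(i < m) P`_i * phi (ringVX ^+ i * x).
Proof.
move=> le_Pm; rewrite /act.
rewrite (big_ord_widen m (fun i => P`_i * phi (ringVX ^+ i * x))) //.
rewrite big_mkcond; apply: eq_bigr => i _; case: ltnP => // le_Pi.
by rewrite nth_default ?mul0r.
Qed.

Lemma actB phi P Q x : act phi (P - Q) x = act phi P x - act phi Q x.
Proof.
pose m := maxn (size P) (size Q).
rewrite !(@act_widen _ _ m) ?leq_maxl ?leq_maxr //; last first.
  by rewrite (leq_trans (size_polyD _ _)) ?size_polyN.
by rewrite -sumrB; apply: eq_bigr => i _; rewrite coefB mulrBl.
Qed.

Lemma actMXn phi n x : act phi 'X^n x = phi (ringVX ^+ n * x).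
Proof.
rewrite /act size_polyXn big_ord_recr /= coefXn eqxx mul1r.
by rewrite big1 ?add0r // => i _; rewrite coefXn ltn_eqF ?mul0r.
Qed.

Lemma actC phi c x : act phi c%:P x = c * phi x.
Proof.
by rewrite (@act_widen _ _ 1) ?size_polyC_leq1 // big_ord1 coefC mul1r.
Qed.

Lemma actMX phi P x : act phi (P * 'X) x = act phi P (ringVX * x).
Proof.
rewrite (@act_widen _ _ (size P).+1); last first.
  by rewrite (leq_trans (size_polyMleq _ _)) // size_polyX addn2.
rewrite big_ord_recl coefMX mul0r add0r; apply: eq_bigr => i _.
by rewrite lift0 coefMX /= exprSr -mulrA.
Qed.

Lemma actMC phi P c x : act phi (P * c%:P) x = c * act phi P x.
Proof.
rewrite mulrC mul_polyC (@act_widen _ _ (size P)) ?size_scale_leq //.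
by rewrite mulr_sumr; apply: eq_bigr => i _; rewrite coefZ mulrA.
Qed.

Lemma iter_ad phi m x : iter m ad phi x = act phi (('X - ringVX%:P) ^+ m) x.
Proof.
elim: m x => [|m IHm] x /=; first by rewrite actC mul1r.
by rewrite exprSr mulrBr actB actMX actMC /ad !IHm.
Qed.

Lemma iter_ad_eq0 p n phi : p \in [pchar V] ->
  (forall x, phi (ringVX ^+ (p ^ n) * x) = ringVX ^+ (p ^ n) * phi x) ->
  iter (p ^ n) ad phi =1 fun=> 0.
Proof.
move=> pV phiX x; have pVX : p \in [pchar {poly V}] by rewrite pchar_poly.
have XtE : ('X - ringVX%:P) ^+ (p ^ n) = 'X^(p ^ n) - (ringVX ^+ (p ^ n))%:P.
  apply/(canRL (addrK _)); rewrite rmorphXn -exprDn_pchar ?subrK //.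
  by rewrite pnatX pnatE ?(pcharf_prime pV) // pVX.
by rewrite iter_ad XtE actB actMXn actC phiX subrr.
Qed.

(** The operator [c d/dt] has commutator [c] with [t], just like [phi], so their difference commutes
    with [t]. The identity is stated in [k[[t]]] because [d/dt] need not preserve [V]. *)
Lemma ad_mul_deriv (phi : V -> V) c :
    zmod_morphism phi -> (forall a x, phi (ringVC a * x) = ringVC a * phi x) ->
    (forall x, ad phi x = c * x) ->
  forall v, ringV_fps (phi v) =
    ringV_fps (phi 1 * v) + ringV_fps c * fps_deriv (ringV_fps v).
Proof.
move=> phiB phiC phiX v.
have phiD x y : phi (x + y) = phi x + phi y.
  have phi0 : phi 0 = 0 by rewrite -(subrr 0) phiB !subrr.
  by rewrite -[y in LHS]opprK phiB -[- y]add0r phiB phi0 sub0r opprK.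
pose E w := ringV_fps (phi w) - ringV_fps (phi 1 * w)
  - ringV_fps c * fps_deriv (ringV_fps w).
have derivD (f h : fps k) : fps_deriv (f + h) = fps_deriv f + fps_deriv h.
  by apply: fpsP => i /=; rewrite mulrnDl.
suff E0 i w : E w i = 0.
  by apply/eqP; rewrite -subr_eq0 opprD addrA; apply/eqP/fpsP => i; apply: E0.
(* The term [c * u] from the product rule cancels the one from the commutator. *)
have EX b u : E (ringVC b + ringVX * u) = fpsX k * E u.
  have phiXu : phi (ringVX * u) = ringVX * phi u + c * u.
    by rewrite -phiX /ad addrC subrK.
  have phib : phi (ringVC b) = ringVC b * phi 1 by rewrite -phiC mulr1.
  rewrite /E phiD phiXu phib !(rmorphD, rmorphM) /=.
  rewrite !ringV_fps_of derivD fps_derivC fps_derivMX add0r.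
  ring.
(* Multiplication by [t] shifts coefficients: coefficient [i.+1] of [E w] is coefficient [i] of
   [E u], so the induction on [i] must hold for all [w]. *)
elim: i w => [|i IHi] w; have [b [u ->]] := ringV_decomp w;
  by rewrite EX mulrC fpsMX.
Qed.

Lemma mul_of_iter_ad (phi : V -> V) m :
    ~ kt_field g (fps_deriv g)%:F ->
    zmod_morphism phi -> (forall a x, phi (ringVC a * x) = ringVC a * phi x) ->
    iter m ad phi =1 (fun=> 0) ->
  forall v, phi v = phi 1 * v.
Proof.
move=> dg; elim: m phi => [|m IHm] phi phiB phiC phi0 v.
  by rewrite [LHS]phi0 [phi 1]phi0 mul0r.
(* [ad phi] inherits additivity and [k]-linearity and is killed by one iterate fewer. *)
have adE x : ad phi x = ad phi 1 * x.
  apply: IHm x => [x y|a x|x]; last by rewrite -iterSr phi0.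
    by rewrite /ad mulrBr !phiB; ring.
  by rewrite /ad mulrCA !phiC; ring.
have phiE := ad_mul_deriv phiB phiC adE.
have c0 : ringV_fps (ad phi 1) = 0.
  apply: contrapT => /eqP c0; apply: dg.
  have := phiE ringVg; rewrite ringV_fps_of => /esym/(canRL (addKr _)) cg.
  (* If [c = ad phi 1] is nonzero, the identity at [g] writes [g'] as a quotient of two elements of
     [V]. *)
  have -> : (fps_deriv g)%:F =
      val (phi ringVg - phi 1 * ringVg) / val (ad phi 1).
    apply: (canRL (mulfK _)); first by rewrite -ringV_fpsK tofrac_eq0.
    by rewrite -!ringV_fpsK -tofracM mulrC cg addrC -rmorphB.
  by apply: kt_fieldV; apply: kt_field_ringV.
by apply: ringV_fps_inj; rewrite phiE c0 mul0r addr0.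
Qed.

End RingVTheory.

(** Iterating the inverse of Frobenius extracts the root; this turns [V^q]-linearity into
    [k]-linearity. *)
Lemma perfect_exprpn (k : fieldType) p (pk : p \in [pchar k]) n (c : k) :
  bijective (pFrobenius_aut pk) -> exists d, c = d ^+ (p ^ n).
Proof.
case=> r _ rK; elim: n c => [|n IHn] c; first by exists c; rewrite expr1.
have [d cd] := IHn (r c); exists d.
by rewrite expnSr exprM -cd -(pFrobenius_autE pk) rK.
Qed.

Theorem theorem5p1 (k : fieldType) (p : nat) (pk : p \in [pchar k])
    (k_perfect : bijective (pFrobenius_aut pk))
    (g : fps k) (g0 : g 0%N = 0) (dg : ~ kt_field g (fps_deriv g)%:F)
    (n : nat) :
  bijective (mul_endo (pchar_ringV g pk) n
    : {rmorphism ringV g -> endo (frobenius_push (pchar_ringV g pk) n)}).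
Proof.
(* The inverse map is evaluation at [1]. *)
pose ev1 (f : endo (frobenius_push (pchar_ringV g pk) n)) : ringV g :=
  f (1 : ringV g).
exists ev1 => [v|f]; first exact: mulr1.
have fZ v (x : ringV g) : f (v ^+ (p ^ n) * x) = v ^+ (p ^ n) * (f x : ringV g).
  exact: (linearZ_LR (endo_fun f) v x).
apply: endoP => v; apply/esym; move: v.
apply: (@mul_of_iter_ad _ _ (f : ringV g -> ringV g) (p ^ n)) => //.
- exact: (raddfB f).
- move=> a x; have [d ->] := perfect_exprpn n a k_perfect.
  have -> : ringVC g (d ^+ (p ^ n)) = ringVC g d ^+ (p ^ n).
    by apply: ringV_fps_inj; rewrite rmorphXn /= !ringV_fps_of rmorphXn.
  exact: fZ.
- by apply: iter_ad_eq0; [apply: pchar_ringV | apply: fZ].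
Qed.
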